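(* Let $\Delta\subset\mathbb Z^r$ be a finite subset with $g=\#\Delta$, and let $(\Lambda_0(t,z),\Lambda_1(t,z),\dots,\Lambda_l(t,z))$ be a $\Delta$-admissible tuple of Laurent polynomials in $\mathbb Z_p[x^{\pm1}]=\mathbb Z_p[t^{\pm1},z^{\pm1}]$. Assume that the determinants of the matrices $A(1,\Lambda_i(t,z))$, $i=0,1,\dots,l$, are Laurent polynomials in $z$ all nonzero modulo $p$. Let $D=D_v=\frac{\partial}{\partial z_v}$. Then $$D\big(\sigma^m\big(A\big(s+1,\Lambda_0\Lambda_1^p\cdots\Lambda_s^{p^s}\big)\big)\big)\cdot\sigma^m\big(A\big(s+1,\Lambda_0\Lambda_1^p\cdots\Lambda_s^{p^s}\big)\big)^{-1}$$ $$\equiv D\big(\sigma^m\big(A\big(s,\Lambda_0\Lambda_1^p\cdots\Lambda_{s-1}^{p^{s-1}}\big)\big)\big)\cdot\sigma^m\big(A\big(s,\Lambda_0\Lambda_1^p\cdots\Lambda_{s-1}^{p^{s-1}}\big)\big)^{-1}\pmod{p^{s+m}}$$ for all $v=1,\dots,n$, $1\le s\le l$ and $m\ge0$.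
   Context: $p$ is an odd prime. $x=(t,z)$, where $t=(t_1,\dots,t_r)$ and $z=(z_1,\dots,z_n)$ are two groups of variables. Newton polytope: for a Laurent polynomial $F(t,z)$, $N(F)\subset\mathbb R^r$ is its Newton polytope with respect to the $t$ variables only (the convex hull of those $v\in\mathbb Z^r$ for which the coefficient of $t^v$ in $F$, a Laurent polynomial in $z$, is nonzero). Admissibility: for a finite set $\Delta\subset\mathbb Z^r$, a tuple $(N_0,\dots,N_l)$ of convex polytopes in $\mathbb R^r$ is $\Delta$-admissible if for all $0\le i\le j<l$ one has $\big(\Delta+N_i+pN_{i+1}+\dots+p^{j-i}N_j\big)\cap p^{j-i+1}\mathbb Z^r\subset p^{j-i+1}\Delta$ (Minkowski sums). A tuple $(\Lambda_0,\dots,\Lambda_l)$ of Laurent polynomials is $\Delta$-admissible if $(N(\Lambda_0),\dots,N(\Lambda_l))$ is. Hasse–Witt matrix: for $v\in\mathbb Z^r$, $\mathrm{Coeff}_vF(t,z)$ is the coefficient of $t^v$ in $F$. For $m\ge1$, $A(m,F(t,z)):=\big(\mathrm{Coeff}_{p^mv-u}F(t,z)\big)_{u\in\Delta,\,v\in\Delta}$, a $g\times g$ matrix of Laurent polynomials in $z$ ($u$ indexes rows, $v$ columns). $\sigma(G(z))=G(z^p)$ with $z^p=(z_1^p,\dots,z_n^p)$, applied to matrices entrywise; derivations are also applied entrywise. Under the hypotheses all the inverted matrices have determinants nonzero modulo $p$. Congruences: a congruence modulo $p^s$ between Laurent polynomials with coefficients in $\mathbb Z_p$ means that all coefficients of the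 difference are divisible by $p^s$. For $g\times g$ matrices $F_1,F_2,G_1,G_2$ over $\mathbb Z_p[z^{\pm1}]$ with $\det F_2,\det G_2$ nonzero modulo $p$, the congruence $F_1F_2^{-1}\equiv G_1G_2^{-1}\pmod{p^s}$ means: writing (Cramer's rule) $F_1F_2^{-1}=F\cdot\frac1{\det F_2}$, $G_1G_2^{-1}=G\cdot\frac1{\det G_2}$ with $F,G$ matrices over $\mathbb Z_p[z^{\pm1}]$, one has $F\cdot\det G_2\equiv G\cdot\det F_2\pmod{p^s}$. *)

(* Defs.v *)
From HB Require Import structures.
From mathcomp Require Import all_boot all_order all_algebra.
From mathcomp Require Import finmap monalg.
From mathcomp Require Import boolp classical_sets reals convex.

Set Implicit Arguments.
Unset Strict Implicit.
Unset Printing Implicit Defensive.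

Import Order.TTheory GRing.Theory Num.Theory.

Local Open Scope fset_scope.
Local Open Scope ring_scope.

(* The p-adic integers, as the inverse limit of the rings Z/p^n: [res x n] is  *)
(* the residue of x modulo p^n, represented in {0, ..., p^n - 1}.  No property *)
(* of p is needed for the ring structure (for p = 1 the ring is trivial, hence *)
(* comPzRingType and not comNzRingType).                                       *)
Record padic (p : nat) := Padic {
  res :> nat -> int;
  resP : forall n, res n = (res n.+1 %% (p ^ n)%N)%Z }.

Section PadicRing.
Variable p : nat.
Implicit Types x y z : padic p.

Lemma padicP x y : (forall n, x n = y n) -> x = y.
Proof.
case: x y => [f fP] [g gP] /= fg; have fgE : f = g by apply/funext.
by case: _ / fgE in gP *; congr Padic; apply: Prop_irrelevance.
Qed.

HB.instance Definition _ := gen_eqMixin (padic p).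
HB.instance Definition _ := gen_choiceMixin (padic p).

Lemma res_mod x n : (x n %% (p ^ n)%N)%Z = x n.
Proof. by rewrite (resP x n) modz_mod. Qed.

Lemma modz_pS (a : int) n :
  ((a %% (p ^ n.+1)%N)%Z %% (p ^ n)%N)%Z = (a %% (p ^ n)%N)%Z.
Proof.
apply/eqP; rewrite eqz_mod_dvd {2}(divz_eq a (p ^ n.+1)%N).
by rewrite opprD addrCA subrr addr0 dvdzE abszN abszM dvdn_mull //= dvdn_exp2l.
Qed.

Lemma reduce_subproof (f : nat -> int)
    (fP : forall n, (f n = f n.+1 %[mod (p ^ n)%N])%Z) n :
  (f n %% (p ^ n)%N)%Z = ((f n.+1 %% (p ^ n.+1)%N)%Z %% (p ^ n)%N)%Z.
Proof. by rewrite modz_pS fP. Qed.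

Definition reduce f fP : padic p := Padic (@reduce_subproof f fP).

Fact const_subproof (a : int) n : (a = a %[mod (p ^ n)%N])%Z.
Proof. by []. Qed.

Fact opp_subproof x n : (- x n = - x n.+1 %[mod (p ^ n)%N])%Z.
Proof. by rewrite (resP x n) modzNm. Qed.

Fact add_subproof x y n : (x n + y n = x n.+1 + y n.+1 %[mod (p ^ n)%N])%Z.
Proof. by rewrite (resP x n) (resP y n) modzDm. Qed.

Fact mul_subproof x y n : (x n * y n = x n.+1 * y n.+1 %[mod (p ^ n)%N])%Z.
Proof. by rewrite (resP x n) (resP y n) modzMm. Qed.

Definition padic_of_int a : padic p := reduce (const_subproof a).
Definition padic_opp x : padic p := reduce (opp_subproof x).
Definition padic_add x y : padic p := reduce (add_subproof x y).
Definition padic_mul x y : padic p := reduce (mul_subproof x y).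

Fact padic_addA : associative padic_add.
Proof. by move=> x y z; apply: padicP => n /=; rewrite modzDml modzDmr addrA. Qed.
Fact padic_addC : commutative padic_add.
Proof. by move=> x y; apply: padicP => n /=; rewrite addrC. Qed.
Fact padic_add0 : left_id (padic_of_int 0) padic_add.
Proof. by move=> x; apply: padicP => n /=; rewrite mod0z add0r res_mod. Qed.
Fact padic_addN : left_inverse (padic_of_int 0) padic_opp padic_add.
Proof. by move=> x; apply: padicP => n /=; rewrite modzDml addNr. Qed.

HB.instance Definition _ := GRing.isZmodule.Build (padic p)
  padic_addA padic_addC padic_add0 padic_addN.

Fact padic_mulA : associative padic_mul.
Proof. by move=> x y z; apply: padicP => n /=; rewrite modzMml modzMmr mulrA. Qed.
Fact padic_mulC : commutative padic_mul.
Proof. by move=> x y; apply: padicP => n /=; rewrite mulrC. Qed.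
Fact padic_mul1 : left_id (padic_of_int 1) padic_mul.
Proof. by move=> x; apply: padicP => n /=; rewrite modzMml mul1r res_mod. Qed.
Fact padic_mulDl : left_distributive padic_mul +%R.
Proof.
move=> x y z; apply: padicP => n /=.
by rewrite modzMml modzDml modzDmr mulrDl.
Qed.

HB.instance Definition _ := GRing.Zmodule_isComPzRing.Build (padic p)
  padic_mulA padic_mulC padic_mul1 padic_mulDl.

End PadicRing.

(* Laurent polynomials in n variables, as finitely supported functions on the  *)
(* exponent lattice Z^n.  [malg] has a multiplication only for exponents in a  *)
(* monoid without nontrivial units, hence the definition of the product here.  *)
Definition laurent (n : nat) (A : comPzRingType) : Type := {malg A['rV[int]_n]}.

Section LaurentRing.
Variables (n : nat) (A : comPzRingType).
Implicit Types F G H : laurent n A.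

HB.instance Definition _ := GRing.Zmodule.on (laurent n A).

Definition laurent_one : laurent n A := << (1 : A) *g (0 : 'rV[int]_n) >>.

Definition laurent_mul F G : laurent n A :=
  \sum_(u <- msupp F) \sum_(v <- msupp G) << F@_u * G@_v *g u + v >>.

Lemma laurent_mulw (d e : {fset 'rV[int]_n}) F G :
  msupp F `<=` d -> msupp G `<=` e ->
  laurent_mul F G =
    \sum_(u <- d) \sum_(v <- e) << F@_u * G@_v *g u + v >>.
Proof.
move=> leF leG; rewrite /laurent_mul (big_fset_incl _ leF) /=.
  apply/eq_bigr=> u _; apply/big_fset_incl => // v _ /mcoeff_outdom ->.
  by rewrite mulr0 monalgU0.
move=> u _ /mcoeff_outdom Fu.
by rewrite big1 => // v _; rewrite Fu mul0r monalgU0.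
Qed.

Fact laurent_mulC : commutative laurent_mul.
Proof.
move=> F G; rewrite /laurent_mul exchange_big /=.
by apply: eq_bigr => u _; apply: eq_bigr => v _; rewrite mulrC [in RHS]addrC.
Qed.

Lemma laurent_mulUU (a b : A) u v :
  laurent_mul << a *g u >> << b *g v >> = << a * b *g u + v >>.
Proof.
by rewrite (laurent_mulw (msuppU_le) (msuppU_le)) !big_seq_fset1 !mcoeffUU.
Qed.

Fact laurent_mulDl : left_distributive laurent_mul +%R.
Proof.
move=> F G H.
rewrite (laurent_mulw (msuppD_le F G) (fsubset_refl _)).
rewrite (laurent_mulw (fsubsetUl (msupp F) (msupp G)) (fsubset_refl (msupp H))).
rewrite (laurent_mulw (fsubsetUr (msupp F) (msupp G)) (fsubset_refl (msupp H))).
rewrite -big_split /=; apply/eq_bigr=> u _.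
rewrite -big_split /=; apply/eq_bigr=> v _.
by rewrite mcoeffD mulrDl monalgUD.
Qed.

Lemma laurent_mul0 F : laurent_mul 0 F = 0.
Proof. by rewrite /laurent_mul msupp0 big_seq_fset0. Qed.

Lemma laurent_sum_mul (I : Type) (r : seq I) (E : I -> laurent n A) F :
  laurent_mul (\sum_(i <- r) E i) F = \sum_(i <- r) laurent_mul (E i) F.
Proof.
exact: (big_morph (laurent_mul^~ F) (fun _ _ => laurent_mulDl _ _ _)
  (laurent_mul0 F)).
Qed.

Lemma laurent_mul_sum (I : Type) (r : seq I) (E : I -> laurent n A) F :
  laurent_mul F (\sum_(i <- r) E i) = \sum_(i <- r) laurent_mul F (E i).
Proof.
rewrite laurent_mulC laurent_sum_mul.
by apply: eq_bigr => i _; rewrite laurent_mulC.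
Qed.

Lemma laurentE F :
  F = \sum_(u <- msupp F) (<< F@_u *g u >> : laurent n A).
Proof. exact: monalgE. Qed.

Fact laurent_mulA : associative laurent_mul.
Proof.
move=> F G H; rewrite (laurentE F) (laurentE G) (laurentE H).
rewrite !laurent_sum_mul; apply: eq_bigr => u _.
rewrite laurent_mul_sum [X in _ = laurent_mul X _]laurent_mul_sum.
rewrite laurent_sum_mul; apply: eq_bigr => v _.
rewrite !laurent_mul_sum; apply: eq_bigr => w _.
by rewrite !laurent_mulUU mulrA addrA.
Qed.

Fact laurent_mul1 : left_id laurent_one laurent_mul.
Proof.
move=> F; rewrite [in RHS](laurentE F) {1}(laurentE F) laurent_mul_sum.
by apply: eq_bigr => u _; rewrite laurent_mulUU mul1r add0r.
Qed.

HB.instance Definition _ := GRing.Zmodule_isComPzRing.Build (laurent n A)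
  laurent_mulA laurent_mulC laurent_mul1 laurent_mulDl.

End LaurentRing.

Section LaurentOperations.
Variables (n : nat) (A : comPzRingType).
Implicit Types F G : laurent n A.

(* sigma : F(z) |-> F(z^p) *)
Definition lsigma (p : nat) F : laurent n A :=
  \sum_(w <- msupp F) << F@_w *g w *+ p >>.

Definition lderiv (v : 'I_n) F : laurent n A :=
  \sum_(w <- msupp F) << F@_w *~ w 0 v *g w - delta_mx 0 v >>.

Definition lcong (p s : nat) F G : Prop :=
  forall w, exists c : A, (F - G)@_w = p%:R ^+ s * c.

(* F1 F2^-1 = G1 G2^-1 modulo p^s.  Since the relation only makes sense when   *)
(* both denominators are nonzero modulo p, this is part of its definition.     *)
Definition lcong_quot (p s g : nat) (F1 F2 G1 G2 : 'M[laurent n A]_g) : Prop :=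
  [/\ ~ lcong p 1 (\det F2) 0,
      ~ lcong p 1 (\det G2) 0
    & forall i j, lcong p s ((F1 *m \adj F2) i j * \det G2)
                            ((G1 *m \adj G2) i j * \det F2)].

End LaurentOperations.

Section Polytopes.
Local Open Scope classical_set_scope.
Variables (R : realType) (r : nat).
Implicit Types A B : set 'rV[R]_r.

Definition minkowski A B : set 'rV[R]_r := [set x + y | x in A & y in B].

Definition dilate (a : R) A : set 'rV[R]_r := [set a *: x | x in A].

Definition convex_hull A : set 'rV[R]_r := smallest (@convex_set R 'rV[R]_r) A.

Definition real_pt (v : 'rV[int]_r) : 'rV[R]_r := map_mx intr v.

Definition newton (S : comPzRingType) (F : laurent r S) : set 'rV[R]_r :=
  convex_hull [set real_pt v | v in [set v | F@_v != 0]].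

Definition admissible (p : nat) (Delta : {fset 'rV[int]_r}) (l : nat)
    (N : 'I_l.+1 -> set 'rV[R]_r) : Prop :=
  let D := [set real_pt v | v in [set v | v \in Delta]] in
  forall i j : 'I_l.+1, (i <= j)%N -> (j < l)%N ->
    minkowski D
      (\big[minkowski/[set 0]]_(k < l.+1 | (i <= k <= j)%N)
         dilate (p ^ (k - i))%:R (N k))
      `&` dilate (p ^ (j - i).+1)%:R (range real_pt)
    `<=` dilate (p ^ (j - i).+1)%:R D.

End Polytopes.

Arguments real_pt R {r} v.
Arguments newton R {r S} F.

(* [F] is a Laurent polynomial in t whose coefficients lie in [A]; the rows    *)
(* and the columns are indexed through the enumeration of [Delta].             *)
Definition hasse_witt (r : nat) (A : comPzRingType) (p : nat)
    (Delta : {fset 'rV[int]_r}) (m : nat) (F : laurent r A) :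
    'M[A]_#|` Delta| :=
  \matrix_(i, j) F@_(Delta`_j *+ p ^ m - Delta`_i).

(* Main.v *)
(* With F_{a..b} the product of the Lambda_(a+k)^(p^k), 0 <= k <= b - a, and   *)
(* tau the substitution (t, z) |-> (t^p, z^p), one can solve recursively        *)
(*   F_{a..b} = sum_(a <= j <= b) G_j tau^(j-a+1) F_{j+1..b}                    *)
(* with G_j depending only on Lambda_a, ..., Lambda_j.  Since x^(p^k) and       *)
(* tau^k x agree modulo p, G_j is divisible by p^(j-a), and its Newton polytope *)
(* lies in N_a + p N_(a+1) + ... + p^(j-a) N_j.  Admissibility then turns the   *)
(* identity into                                                                *)
(*   A_{a..b} = sum_j C_j sigma^(j-a+1) A_{j+1..b},  with p^(j-a) | C_j,        *)
(* where C_j does not depend on b.  Comparing the expansions for b = s and      *)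
(* b = s - 1, descending induction on a first gives the Dwork congruences for   *)
(* the ratios A_{e..b} A_{a..b}^-1, and then, as D (sigma^m _) is divisible by  *)
(* p^m, the congruence for the logarithmic derivatives.                         *)

From HB Require Import structures.
Require Import Defs.
From mathcomp Require Import all_boot all_order all_algebra.
From mathcomp Require Import perm finmap reals.
From mathcomp Require Import monalg boolp classical_sets convex.

Set Implicit Arguments.
Unset Strict Implicit.
Unset Printing Implicit Defensive.

Import Order.TTheory GRing.Theory Num.Theory.
Local Open Scope ring_scope.

(** * Congruences of quotients of matrices *)

(** Let X_{a,t} be sigma^(m+a) of the Hasse-Witt matrix of the window product Lambda_a
    Lambda_{a+1}^p ... Lambda_{t-1}^(p^(t-a-1)). Expanding this product along lifts of Frobenius
    ([window_coef_ndvd], [window_coef_supported]) and using admissibility ([hasse_wittM],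
    [hasse_witt_window]) gives X_{a,t} = sum_{a <= j < t} c_{a,j} X_{j+1,t}, where c_{a,j} is
    independent of t and divisible by p^(j-a), and det c_{a,a} is nonzero modulo p. As c_{a,j} lies
    in the image of sigma^(m+a), differentiation yields a further p^(m+a), so p^(m+j) divides D
    c_{a,j}.

    The rest is linear algebra over Z_p[z^{±1}], where (p) is a prime ideal by Gauss's lemma
    ([laurent_prime]), so that one may localise there. Put P_a = (X_{a,s+1} | X_{a,s}); for a < s
    both blocks obey the same recursion up to an error divisible by p^(s-a). The theorem follows
    from D P_0 = W P_0 modulo p^(s+m) with a single W, which is then both logarithmic derivatives at
    once ([approx_quot]). Inverting the recursion step by step, [approx_ratio] writes P_e as a
    multiple of P_a modulo p^(s+1-e). Then [approx_derive] applies Leibniz to the recursion: the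
    precision missing in these ratios is supplied by the factor p^(m+j) of D c_{a,j}. *)

Definition ndvd (V : zmodType) (q : nat) (x : V) := exists y, x = y *+ q.

Section Ndvd.
Variable q : nat.

Lemma ndvd0 (V : zmodType) : ndvd q (0 : V).
Proof. by exists 0; rewrite mul0rn. Qed.

Lemma ndvdD (V : zmodType) (x y : V) : ndvd q x -> ndvd q y -> ndvd q (x + y).
Proof. by move=> [a ->] [b ->]; exists (a + b); rewrite mulrnDl. Qed.

Lemma ndvdN (V : zmodType) (x : V) : ndvd q x -> ndvd q (- x).
Proof. by move=> [a ->]; exists (- a); rewrite mulNrn. Qed.

Lemma ndvdB (V : zmodType) (x y : V) : ndvd q x -> ndvd q y -> ndvd q (x - y).
Proof. by move=> qx /ndvdN; apply: ndvdD. Qed.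

Lemma ndvd_sum (V : zmodType) (I : Type) (s : seq I) (P : pred I) (E : I -> V) :
  (forall i, P i -> ndvd q (E i)) -> ndvd q (\sum_(i <- s | P i) E i).
Proof. by move=> qE; apply: big_ind => //; [apply: ndvd0|apply: ndvdD]. Qed.

Lemma ndvd_dvd (V : zmodType) q' (x : V) : (q %| q')%N -> ndvd q' x -> ndvd q x.
Proof. by move=> /dvdnP[k ->] [y ->]; exists (y *+ k); rewrite -mulrnA. Qed.

Lemma ndvd_raddf (U V : zmodType) (f : {additive U -> V}) x :
  ndvd q x -> ndvd q (f x).
Proof. by move=> [y ->]; exists (f y); rewrite raddfMn. Qed.

Lemma ndvd_mul (K : pzRingType) q' (x y : K) :
  ndvd q x -> ndvd q' y -> ndvd (q * q') (x * y).
Proof.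
by move=> [a ->] [b ->]; exists (a * b); rewrite mulrnAr mulrnAl mulrnA.
Qed.

Lemma ndvd_mull (K : pzRingType) (x y : K) : ndvd q y -> ndvd q (x * y).
Proof. by move=> [b ->]; exists (x * b); rewrite mulrnAr. Qed.

Lemma ndvd_mulr (K : pzRingType) (x y : K) : ndvd q x -> ndvd q (x * y).
Proof. by move=> [b ->]; exists (b * y); rewrite mulrnAl. Qed.

Lemma ndvdMn (V : zmodType) q' (x : V) : ndvd q x -> ndvd (q * q') (x *+ q').
Proof. by move=> [a ->]; exists a; rewrite -mulrnA. Qed.

Section Matrices.
Variables (K : comPzRingType) (g h : nat).

Lemma ndvd_mxP (X : 'M[K]_(g, h)) : ndvd q X <-> forall i j, ndvd q (X i j).
Proof.
split=> [[Y ->] i j|qX]; first by exists (Y i j); rewrite mulmxnE.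
have /fin_all_exists[f fP] : forall u : 'I_g * 'I_h, exists y, X u.1 u.2 = y *+ q.
  by move=> u; apply: qX.
exists (\matrix_(i, j) f (i, j)); apply/matrixP=> i j.
by rewrite mulmxnE mxE -(fP (i, j)).
Qed.

Lemma ndvd_mulmxl k (Y : 'M[K]_(k, g)) (X : 'M_(g, h)) :
  ndvd q X -> ndvd q (Y *m X).
Proof. by move=> [Z ->]; exists (Y *m Z); rewrite raddfMn. Qed.

Lemma ndvd_mulmxr k (X : 'M[K]_(g, h)) (Y : 'M_(h, k)) :
  ndvd q X -> ndvd q (X *m Y).
Proof. by move=> [Z ->]; exists (Z *m Y); apply: (raddfMn (mulmxr Y)). Qed.

Lemma ndvd_scale (a : K) (X : 'M[K]_(g, h)) : ndvd q X -> ndvd q (a *: X).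
Proof. by move=> [Z ->]; exists (a *: Z); rewrite scalerMnr. Qed.

End Matrices.

Lemma ndvd_row_mx (K : comPzRingType) g h k (X : 'M[K]_(g, h)) (Y : 'M_(g, k)) :
  ndvd q X -> ndvd q Y -> ndvd q (row_mx X Y).
Proof.
move=> /ndvd_mxP qX /ndvd_mxP qY; apply/ndvd_mxP => i j.
by rewrite mxE; case: splitP => j' _.
Qed.

Lemma ndvd_mulmx (K : comPzRingType) f g h q' (X : 'M[K]_(f, g)) (Y : 'M_(g, h)) :
  ndvd q X -> ndvd q' Y -> ndvd (q * q') (X *m Y).
Proof.
move=> [Z ->] [Z' ->]; exists (Z *m Z').
by rewrite raddfMn /= (raddfMn (mulmxr Z') q Z : _ *m Z' = _) mulrnA.
Qed.

Lemma ndvd_prodB (K : comPzRingType) (I : Type) (s : seq I) (P : pred I)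
    (E E' : I -> K) :
  (forall i, P i -> ndvd q (E i - E' i)) ->
  ndvd q (\prod_(i <- s | P i) E i - \prod_(i <- s | P i) E' i).
Proof.
move=> qE; apply: (big_ind2 (fun x y => ndvd q (x - y))) => //.
  by rewrite subrr; apply: ndvd0.
move=> x x' y y' qx qy.
have -> : x * y - x' * y' = x * (y - y') + (x - x') * y'.
  by rewrite mulrBr mulrBl addrA subrK.
by apply: ndvdD; [apply: ndvd_mull|apply: ndvd_mulr].
Qed.

Lemma ndvd_detB (K : comPzRingType) g (X Y : 'M[K]_g) :
  ndvd q (X - Y) -> ndvd q (\det X - \det Y).
Proof.
move=> /ndvd_mxP qXY; rewrite /determinant -sumrB; apply: ndvd_sum => s _.
rewrite -mulrBr; apply: ndvd_mull; apply: ndvd_prodB => i _.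
by have := qXY i (s i); rewrite !mxE.
Qed.

End Ndvd.

Lemma ndvd1 (V : zmodType) (x : V) : ndvd 1 x.
Proof. by exists x. Qed.

Lemma ndvd_exp2l (V : zmodType) p k k' (x : V) :
  (k <= k')%N -> ndvd (p ^ k') x -> ndvd (p ^ k) x.
Proof. by move=> kk'; apply: ndvd_dvd; apply: dvdn_exp2l. Qed.

(** * Matrix congruences over the localisation at (p) *)

Section Approx.
Variables (p : nat) (K : comPzRingType).
Hypothesis mulp_inj : forall x : K, x *+ p = 0 -> x = 0.
Hypothesis p_prime : forall x y : K, ndvd p (x * y) -> ndvd p x \/ ndvd p y.
Hypothesis p_nunit : ~ ndvd p (1 : K).

Let p_nmul (x y : K) : ~ ndvd p x -> ~ ndvd p y -> ~ ndvd p (x * y).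
Proof. by move=> px py /p_prime[]. Qed.

(** Denominators prime to p can be cleared: primality of (p) extracts one factor p from [x], and
    injectivity of multiplication by p removes it from both sides. *)
Lemma ndvd_cancel k (d x : K) : ~ ndvd p d -> ndvd (p ^ k) (d * x) -> ndvd (p ^ k) x.
Proof.
move=> pd; elim: k x => [|k IHk] x; first by move=> _; apply: ndvd1.
move=> dx; have : ndvd p (d * x) by apply: ndvd_dvd dx; rewrite expnS dvdn_mulr.
case/p_prime => // -[y def_x]; move: dx; rewrite {}def_x => -[z].
rewrite mulrnAr expnSr mulrnA => /eqP; rewrite -subr_eq0 -mulrnBl => /eqP/mulp_inj.
move/eqP; rewrite subr_eq0 => /eqP dy; have [|w ->] := IHk y; first by exists z.
by exists w; rewrite mulrnA.
Qed.

(* In the localisation at the prime ideal (p), this says that P = W R modulo   *)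
(* p^k for some matrix W divisible by p^i; the denominator of W is d.          *)
Definition approx (i k g h : nat) (P R : 'M[K]_(g, h)) :=
  exists d, exists W : 'M[K]_g,
    [/\ ~ ndvd p d, ndvd (p ^ i) W & ndvd (p ^ k) (d *: P - W *m R)].

Section ApproxTheory.
Variables g h : nat.
Implicit Types P R S : 'M[K]_(g, h).

Lemma approxW i k i' k' P R :
  (i <= i')%N -> (k <= k')%N -> approx i' k' P R -> approx i k P R.
Proof.
move=> ii' kk' [d [W [pd pW e]]]; exists d, W.
by split=> //; [apply: ndvd_exp2l pW|apply: ndvd_exp2l e].
Qed.

Lemma approx_small i k P R : ndvd (p ^ k) P -> approx i k P R.
Proof.
move=> pP; exists 1, 0; split=> //; first exact: ndvd0.
by rewrite scale1r mul0mx subr0.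
Qed.

Lemma approx_refl k P : approx 0 k P P.
Proof.
exists 1, 1%:M; split=> //; first exact: ndvd1.
by rewrite scale1r mul1mx subrr; apply: ndvd0.
Qed.

Lemma approxD i k P P' R : approx i k P R -> approx i k P' R -> approx i k (P + P') R.
Proof.
move=> [d [W [pd pW e]]] [d' [W' [pd' pW' e']]].
exists (d * d'), (d' *: W + d *: W'); split; first exact: p_nmul.
  by apply: ndvdD; apply: ndvd_scale.
suff -> : (d * d') *: (P + P') - (d' *: W + d *: W') *m R =
    d' *: (d *: P - W *m R) + d *: (d' *: P' - W' *m R).
  by apply: ndvdD; apply: ndvd_scale.
rewrite mulmxDl -!scalemxAl scalerDr !scalerBr !scalerA (mulrC d' d) opprD.
by rewrite addrACA.
Qed.

Lemma approx_sum i k (I : eqType) (s : seq I) (E : I -> 'M[K]_(g, h)) R :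
  (forall j, j \in s -> approx i k (E j) R) -> approx i k (\sum_(j <- s) E j) R.
Proof.
move=> eE; rewrite big_seq; apply: (big_ind (fun X => approx i k X R)) eE.
  by apply: approx_small; exact: ndvd0.
by move=> X Y; apply: approxD.
Qed.

Lemma approx_mulmx a i k (c : 'M[K]_g) P R :
  ndvd (p ^ a) c -> approx i k P R -> approx (a + i) (a + k) (c *m P) R.
Proof.
move=> pc [d [W [pd pW e]]]; exists d, (c *m W); split=> //.
  by rewrite expnD; apply: ndvd_mulmx.
by rewrite scalemxAr -mulmxA -mulmxBr expnD; apply: ndvd_mulmx.
Qed.

(** The error of the second relation is multiplied by the first matrix [W], whose factor p^i adds to
    its precision. *)
Lemma approx_trans i k l P R S : (k <= i + l)%N ->
  approx i k P R -> approx 0 l R S -> approx i k P S.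
Proof.
move=> kil [d [W [pd pW e]]] [d' [W' [pd' pW' e']]].
exists (d' * d), (W *m W'); split; [exact: p_nmul|exact: ndvd_mulmxr|].
have -> : (d' * d) *: P - (W *m W') *m S =
    d' *: (d *: P - W *m R) + W *m (d' *: R - W' *m S).
  by rewrite scalerBr scalerA mulmxBr -mulmxA -scalemxAr addrA subrK.
apply: ndvdD; first exact: ndvd_scale.
by apply: ndvd_exp2l kil _; rewrite expnD; apply: ndvd_mulmx.
Qed.

(** Cramer's rule: [\adj Q] inverts [Q] at the cost of the admissible denominator [\det Q]. *)
Lemma approx_inv k d (Q : 'M[K]_g) P R : ~ ndvd p (\det Q) ->
  ndvd (p ^ k) (d *: P - Q *m R) -> approx 0 k R P.
Proof.
move=> pQ e; exists (\det Q), (d *: \adj Q); split=> //; first exact: ndvd1.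
have -> : \det Q *: R - d *: \adj Q *m P = \adj Q *m (Q *m R - d *: P).
  by rewrite mulmxBr mulmxA mul_adj_mx mul_scalar_mx -scalemxAl -scalemxAr.
by apply: ndvd_mulmxl; rewrite -opprB; apply: ndvdN.
Qed.

(** Here P = (c + W / d) R with p dividing W, and c + W / d stays invertible in the localisation
    because det (d c + W) is d^g det c modulo p. *)
Lemma approx_step k (c : 'M[K]_g) P R : ~ ndvd p (\det c) ->
  approx 1 k (P - c *m R) R -> approx 0 k R P.
Proof.
move=> pc [d [W [pd pW e]]]; apply: (@approx_inv k d (d *: c + W)); last first.
  by move: e; rewrite mulmxDl -scalemxAl opprD addrA scalerBr.
move=> pQ; have : ndvd p (\det (d *: c)).
  rewrite -[\det _](subKr (\det (d *: c + W))); apply: ndvdB => //.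
  by apply: ndvd_detB; rewrite addrAC subrr add0r -[p]expn1.
rewrite detZ; apply: p_nmul => //; elim: g => [|n IHn]; first by rewrite expr0.
by rewrite exprS; apply: p_nmul.
Qed.

End ApproxTheory.

(** The same W / d plays the role of both Y' Y^-1 and Z' Z^-1; after cross-multiplication by
    adjugates its two contributions cancel. *)
Lemma approx_quot i k g (Y' Z' Y Z : 'M[K]_g) :
  approx i k (row_mx Y' Z') (row_mx Y Z) ->
  forall i' j, ndvd (p ^ k) ((Y' *m \adj Y) i' j * \det Z - (Z' *m \adj Z) i' j * \det Y).
Proof.
move=> [d [W [pd _]]]; rewrite scale_row_mx mul_mx_row opp_row_mx add_row_mx => e.
have eY : ndvd (p ^ k) (d *: Y' - W *m Y).
  by rewrite -(row_mxKl (d *: Y' - W *m Y) (d *: Z' - W *m Z)); apply: ndvd_raddf.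
have eZ : ndvd (p ^ k) (d *: Z' - W *m Z).
  by rewrite -(row_mxKr (d *: Y' - W *m Y) (d *: Z' - W *m Z)); apply: ndvd_raddf.
pose X := \det Z *: (Y' *m \adj Y) - \det Y *: (Z' *m \adj Z).
suff /ndvd_mxP dX : ndvd (p ^ k) (d *: X).
  move=> i' j; apply: (ndvd_cancel pd); rewrite ![_ * \det _]mulrC.
  by have := dX i' j; rewrite /X; do 6!rewrite mxE.
have -> : d *: X = \det Z *: ((d *: Y' - W *m Y) *m \adj Y) -
                   \det Y *: ((d *: Z' - W *m Z) *m \adj Z).
  rewrite !mulmxBl -!mulmxA !mul_mx_adj !mul_mx_scalar !scalerBr -!scalemxAl.
  rewrite !scalerA !(mulrC d) (mulrC (\det Y) (\det Z)) opprB addrA subrK.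
  by [].
by apply: ndvdB; apply: ndvd_scale; apply: ndvd_mulmxr.
Qed.

(** * Descent along the recursion, for ratios and for derivatives *)

Section Descent.
Variables (g h b m : nat) (D : {additive K -> K}).
Hypothesis DM : forall x y, D (x * y) = D x * y + x * D y.
Variables (c : nat -> nat -> 'M[K]_g) (P eps : nat -> 'M[K]_(g, h)).
Local Notation DD := (map_mx D).
Hypothesis defP : forall a, (a <= b)%N ->
  P a = \sum_(a <= j < b) c a j *m P j.+1 + eps a.
Hypothesis c_small : forall a j, (a <= j < b)%N -> ndvd (p ^ (j - a)) (c a j).
Hypothesis eps_small : forall a, (a < b)%N -> ndvd (p ^ (b - a)) (eps a).
Hypothesis Dc_small : forall a j, (a <= j < b)%N -> ndvd (p ^ (m + j)) (DD (c a j)).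
Hypothesis Deps_small : forall a, (a <= b)%N -> ndvd (p ^ (m + b)) (DD (eps a)).
Hypothesis det_c : forall a, (a < b)%N -> ~ ndvd p (\det (c a a)).

Lemma derive_mulmx f k l (X : 'M[K]_(f, k)) (Y : 'M_(k, l)) :
  DD (X *m Y) = DD X *m Y + X *m DD Y.
Proof.
apply/matrixP=> i j; rewrite !mxE raddf_sum -big_split /=.
by apply: eq_bigr => k' _; rewrite DM !mxE.
Qed.

(** The Dwork congruences. By descending induction on [a], all terms of the recursion for [P a]
    beyond the first are multiples of [P a.+1] by matrices divisible by p, so the step from [P a.+1]
    to [P a] is invertible. *)
Lemma approx_ratio a e : (a <= e <= b)%N -> approx 0 (b.+1 - e) (P e) (P a).
Proof.
move: {2}(b - a)%N (erefl (b - a)%N) => n; elim: n => [|n IHn] in a e *.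
  move=> ba /andP[ae eb]; suff -> : e = a by apply: approx_refl.
  by apply/eqP; rewrite eqn_leq ae (leq_trans eb) // -subn_eq0 ba.
move=> ba /andP[ae eb]; have ab : (a < b)%N by rewrite -subn_gt0 ba.
have {}IHn e' : (a < e' <= b)%N -> approx 0 (b.+1 - e') (P e') (P a.+1).
  by apply: IHn; rewrite subnS ba.
move: ae; rewrite leq_eqVlt => /predU1P[<-|ae]; first exact: approx_refl.
(* Only the step from a to a + 1 needs inverting; its precision b - a is at least b + 1 - e since a
   < e. *)
apply: (approx_trans (R := P a.+1)) (_ : approx 0 (b - a) _ _); last 1 first.
- apply: (approx_step (det_c ab)).
  have -> : P a - c a a *m P a.+1 = \sum_(a.+1 <= j < b) c a j *m P j.+1 + eps a.
    by apply/eqP; rewrite subr_eq addrC addrA -big_ltn // -defP // ltnW.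
  apply: approxD; last by apply: approx_small; apply: eps_small.
  apply: approx_sum => j; rewrite mem_index_iota => /andP[aj jb].
  (* The factor p^(j-a) of [c a j] raises the inductive precision b - j to b - a, and makes the
     multiplier divisible by p since a < j. *)
  apply: approxW (approx_mulmx (c_small _) (IHn j.+1 _)).
  + by rewrite addn0 subn_gt0.
  + by rewrite subSS addnC addnBA ?(ltnW aj) // subnK // ltnW.
  + by rewrite ltnW.
  + by rewrite ltnS (ltnW aj).
- by rewrite add0n -(subSS a b); apply: leq_sub2l.
- by apply: IHn; rewrite ae.
Qed.

(** By Leibniz, each term of the recursion gives two. In D(c) P the factor p^(m+j) of D(c) completes
    the precision b - j of [approx_ratio]; in c D(P) the inductive multiplier has the factor
    p^(m+j+1), which does the same. *)
Lemma approx_derive a : (a <= b)%N -> approx (m + a) (m + b) (DD (P a)) (P a).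
Proof.
move: {2}(b - a)%N (erefl (b - a)%N) => n; elim/ltn_ind: n => n IHn in a *.
move=> ba ab; rewrite {1}defP // raddfD raddf_sum /=.
apply: approxD; last by apply: approx_small; apply: Deps_small.
apply: approx_sum => j; rewrite mem_index_iota => /andP[aj jb].
have ajb : (a <= j.+1 <= b)%N by rewrite leqW.
have jbj : (m + j + (b.+1 - j.+1) = m + b)%N by rewrite subSS -addnA subnKC // ltnW.
rewrite derive_mulmx; apply: approxD.
  have Dc : ndvd (p ^ (m + j)) (DD (c a j)) by apply: Dc_small; rewrite aj.
  have := approx_mulmx Dc (approx_ratio ajb); rewrite jbj.
  by apply: approxW; rewrite ?addn0 ?leq_add2l.
have IHj : approx (m + j.+1) (m + b) (DD (P j.+1)) (P j.+1).
  by apply: (IHn (b - j.+1)%N); rewrite // -ba ltn_sub2l // (leq_ltn_trans aj).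
apply: (approxW (i' := (m + j)%N) (k' := (m + b)%N)) => //; first by rewrite leq_add2l.
apply: approx_trans (approx_ratio ajb); first by rewrite jbj.
apply: approxW (approx_mulmx (a := 0) (ndvd1 _) IHj); last by rewrite add0n.
by rewrite add0n leq_add2l leqW.
Qed.

End Descent.

(** * Two consecutive windows compared *)

Section WindowSystem.
Variables (g m l : nat) (D : {additive K -> K}).
Hypothesis DM : forall x y, D (x * y) = D x * y + x * D y.
Local Notation DD := (map_mx D).
Variables c X : nat -> nat -> 'M[K]_g.
Hypothesis X_nil : forall a, X a a = 1%:M.
Hypothesis X_rec : forall a t, (a < t <= l.+1)%N ->
  X a t = \sum_(a <= j < t) c a j *m X j.+1 t.
Hypothesis c_small : forall a j, (a <= j <= l)%N -> ndvd (p ^ (j - a)) (c a j).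
Hypothesis Dc_small : forall a j, (a <= j <= l)%N -> ndvd (p ^ (m + j)) (DD (c a j)).
Hypothesis det_c : forall a, (a <= l)%N -> ~ ndvd p (\det (c a a)).

(** Modulo p only the term j = a of [X_rec] survives, so the determinant is the product of those of
    the [c j j], a <= j < t. *)
Lemma det_window a t : (a <= t <= l.+1)%N -> ~ ndvd p (\det (X a t)).
Proof.
move: {2}(t - a)%N (erefl (t - a)%N) => n; elim: n => [|n IHn] in a *.
  move=> ta /andP[le_at _]; suff -> : a = t by rewrite X_nil det1.
  by apply/eqP; rewrite eqn_leq le_at -subn_eq0 ta.
move=> ta /andP[_ tl]; have lt_at : (a < t)%N by rewrite -subn_gt0 ta.
have al : (a <= l)%N by rewrite -ltnS (leq_trans lt_at).
have pX : ~ ndvd p (\det (c a a *m X a.+1 t)).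
  rewrite det_mulmx; apply: p_nmul; first exact: det_c.
  by apply: IHn; rewrite ?lt_at // subnS ta.
move=> pdet; apply: pX; rewrite -[\det _](subKr (\det (X a t))).
apply: ndvdB => //; apply: ndvd_detB; rewrite X_rec ?lt_at // big_ltn // addrC addKr.
rewrite big_nat; apply: ndvd_sum => j /andP[aj jt]; apply: ndvd_mulmxr.
have := @c_small a j; rewrite (ltnW aj) -ltnS (leq_trans jt tl) => /(_ isT).
by apply: ndvd_dvd; rewrite -(subnSK aj) expnS dvdn_mulr.
Qed.

Lemma window_derive_quot s : (s <= l)%N ->
  forall i j, ndvd (p ^ (m + s))
    ((DD (X 0 s.+1) *m \adj (X 0 s.+1)) i j * \det (X 0 s) -
     (DD (X 0 s) *m \adj (X 0 s)) i j * \det (X 0 s.+1)).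
Proof.
move=> sl; pose P a := row_mx (X a s.+1) (X a s).
(* In the left block the term j = s is left over, with X s+1 s+1 = 1. In the right block nothing is
   left over except at a = s, where X s s = 1 is the initial value; it is killed by [D]. *)
pose eps a := row_mx (c a s) (if a == s then 1%:M else 0).
have D1 : D 1 = 0.
  have := DM 1 1; rewrite !mulr1 mul1r => /eqP.
  by rewrite -subr_eq0 opprD addrA subrr sub0r oppr_eq0 => /eqP.
have DD1 : DD (1%:M : 'M[K]_g) = 0.
  by apply/matrixP=> i j; rewrite !mxE raddfMn /= D1 mul0rn.
apply: (@approx_quot (m + 0)%N); rewrite -map_row_mx.
apply: (approx_derive DM (c := c) (P := P) (eps := eps)) => // [a|a j|a|a j|a|a].
- rewrite leq_eqVlt => /predU1P[->|lt_as].
    rewrite /P /eps big_geq // add0r eqxx X_nil X_rec ?leqnn //.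
    by rewrite big_nat1 X_nil mulmx1.
  have Xs : X a s = \sum_(a <= j < s) c a j *m X j.+1 s.
    by apply: X_rec; rewrite lt_as leqW.
  have Xs1 : X a s.+1 = \sum_(a <= j < s) c a j *m X j.+1 s.+1 + c a s.
    rewrite X_rec; last by rewrite !ltnS (ltnW lt_as).
    by rewrite big_nat_recr ?(ltnW lt_as) //= X_nil mulmx1.
  rewrite /P Xs Xs1 /eps ltn_eqF //.
  rewrite -[X in row_mx _ X]addr0 -add_row_mx; congr (_ + _).
  elim/big_ind3: _ => [|x1 x2 x3 y1 y2 y3 e1 e2|j _].
  - by rewrite row_mx0.
  - by rewrite -add_row_mx -e1 -e2.
  by rewrite mul_mx_row.
- by move=> /andP[aj js]; apply: c_small; rewrite aj (leq_trans (ltnW js)).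
- move=> lt_as; rewrite /eps ltn_eqF //; apply: ndvd_row_mx; last exact: ndvd0.
  by apply: c_small; rewrite (ltnW lt_as).
- by move=> /andP[aj js]; apply: Dc_small; rewrite aj (leq_trans (ltnW js)).
- move=> le_as; rewrite /eps map_row_mx; apply: ndvd_row_mx.
    by apply: Dc_small; rewrite le_as.
  by case: eqP => _; rewrite ?DD1 ?raddf0; apply: ndvd0.
by move=> lt_as; apply: det_c; apply: leq_trans (ltnW lt_as) sl.
Qed.

End WindowSystem.
End Approx.

(** * The p-adic integers *)

Section Padic.
Variables (p : nat) (p_pr : prime p).
Let p_gt0 : (0 < p)%N := prime_gt0 p_pr.
Let p_neq0 : p%:Z != 0.
Proof. by rewrite eqz_nat -lt0n. Qed.

Lemma padic_resMn (x : padic p) k n : res (x *+ k) n = ((x n *+ k) %% (p ^ n)%N)%Z.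
Proof.
elim: k => [|k IHk]; first by rewrite !mulr0n.
by rewrite !mulrS -[in RHS]modzDmr -IHk.
Qed.

Lemma padic_resX (x : padic p) k n : res (x ^+ k) n = ((x n ^+ k) %% (p ^ n)%N)%Z.
Proof.
elim: k => [|k IHk]; first by rewrite !expr0.
by rewrite !exprS -[in RHS]modzMmr -IHk.
Qed.

Lemma padic_res_le (x : padic p) m n : (m <= n)%N -> (x m = x n %[mod (p ^ m)%N])%Z.
Proof.
move=> /subnK <-; elim: (n - m)%N => [|k IHk] //; rewrite IHk addSn.
rewrite [x (k + m)%N]resP expnD PoszM; apply/eqP; rewrite eqz_mod_dvd.
rewrite {2}(divz_eq (x (k + m).+1) ((p ^ k)%N%:Z * (p ^ m)%N)).
by rewrite opprD addrCA subrr addr0 dvdzE abszN !abszM dvdn_mull //= dvdn_mull.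
Qed.

Lemma padic_mulp_inj (x : padic p) : x *+ p = 0 -> x = 0.
Proof.
move=> xp; apply: padicP => n; rewrite (resP x n) /= mod0z.
have : res (x *+ p) n.+1 = 0 by rewrite xp /= mod0z.
rewrite padic_resMn -mulr_natr natz expnSr PoszM => /dvdz_mod0P.
by rewrite dvdz_mul2r // => /dvdz_mod0P.
Qed.

(** The quotient by p is built with a shift: its residue modulo p^n comes from dividing the residue
    of [x] modulo p^(n+1) by p. *)
Lemma ndvd_padic (x : padic p) : ndvd p x <-> res x 1 = 0.
Proof.
split=> [[y ->]|x1]; first by rewrite padic_resMn expn1 -mulr_natr natz modzMl.
have dvdx n : x n.+1 = (x n.+1 %/ p)%Z * p.
  have /eqP := @padic_res_le x 1 n.+1 isT; rewrite x1 expn1 mod0z eq_sym.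
  by move=> /eqP/dvdz_mod0P/divzK.
have fP n : ((x n.+1 %/ p)%Z = (x n.+2 %/ p)%Z %[mod (p ^ n)%N])%Z.
  have /eqP := @padic_res_le x n.+1 n.+2 (leqnSn _); rewrite eqz_mod_dvd (dvdx n) (dvdx n.+1).
  rewrite -mulrBl expnSr PoszM dvdz_mul2r //.
  by rewrite -eqz_mod_dvd !mulzK // => /eqP.
exists (reduce fP); apply: padicP => n; rewrite padic_resMn /=.
by rewrite -mulr_natr natz modzMml -dvdx (resP x n).
Qed.

Lemma padic_prime (x y : padic p) : ndvd p (x * y) -> ndvd p x \/ ndvd p y.
Proof.
rewrite !ndvd_padic /= expn1 => /dvdz_mod0P.
rewrite dvdzE abszM Euclid_dvdM // => /orP[] xy; [left|right].
  by rewrite -(res_mod x 1) expn1; apply/dvdz_mod0P.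
by rewrite -(res_mod y 1) expn1; apply/dvdz_mod0P.
Qed.

Lemma padic1_ndvd : ~ ndvd p (1 : padic p).
Proof.
rewrite ndvd_padic /= expn1 => /dvdz_mod0P; rewrite dvdzE /=.
by rewrite gtnNdvd ?prime_gt1.
Qed.

(** Fermat's little theorem on the residue modulo p: the identity of Z_p lifts Frobenius. *)
Lemma padic_fermat k (x : padic p) : ndvd p (x ^+ (p ^ k) - x).
Proof.
rewrite ndvd_padic /= padic_resX modzDmr modzDml expn1; apply/dvdz_mod0P.
rewrite -eqz_mod_dvd -(res_mod x 1) expn1.
case: (x 1%N %% p)%Z (@modz_ge0 (x 1%N) p p_neq0) => [a _|] //.
have -> e : a%:Z ^+ e = (a ^ e)%N by elim: e => // e; rewrite exprS expnS PoszM => ->.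
rewrite !modz_nat eqz_nat; elim: k => [|k IHk]; first by rewrite expn0 expn1.
by rewrite expnSr expnM fermat_little.
Qed.

End Padic.

(** * Powers modulo p *)

Section FrobeniusPower.
Variables (p : nat) (p_pr : prime p) (K : comPzRingType).
Implicit Types x y : K.

Lemma ndvd_exprB q n x y : ndvd q (x - y) -> ndvd q (x ^+ n - y ^+ n).
Proof.
by move=> qxy; rewrite subrXX; apply: ndvd_mulr.
Qed.

Lemma ndvd_exprDp x y : ndvd p ((x + y) ^+ p - (x ^+ p + y ^+ p)).
Proof.
case: p p_pr => // n n_pr; rewrite exprDn big_ord_recl big_ord_recr /=.
rewrite subn0 bin0 mulr1n expr0 mulr1 subnn binn mulr1n expr0 mul1r.
rewrite addrCA addrK; apply: ndvd_sum => i _.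
have /dvdnP[k ->] : (n.+1 %| 'C(n.+1, bump 0 i))%N.
  by apply: prime_dvd_bin => //; rewrite /bump /= add1n ltnS.
by rewrite mulrnA; exists ((x ^+ (n.+1 - bump 0 i) * y ^+ bump 0 i) *+ k).
Qed.

Lemma ndvd_exprDpn k x y :
  ndvd p ((x + y) ^+ (p ^ k) - (x ^+ (p ^ k) + y ^+ (p ^ k))).
Proof.
elim: k => [|k IHk]; first by rewrite expn0 !expr1 subrr; apply: ndvd0.
rewrite expnSr !exprM.
have := ndvdD (ndvd_exprB p IHk) (ndvd_exprDp (x ^+ (p ^ k)) (y ^+ (p ^ k))).
by rewrite addrA subrK.
Qed.

(** In x^p - y^p = (x - y) S, the cofactor S has p terms, all congruent to x^(p-1) modulo p, hence
    is itself divisible by p. *)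
Lemma ndvd_exprp_lift i x y : (0 < i)%N ->
  ndvd (p ^ i) (x - y) -> ndvd (p ^ i.+1) (x ^+ p - y ^+ p).
Proof.
move=> i_gt0 xy; rewrite subrXX expnSr; apply: ndvd_mul => //.
have pxy : ndvd p (y - x).
  by rewrite -opprB; apply: ndvdN; rewrite -[p]expn1; apply: ndvd_exp2l xy.
rewrite -[\sum_(i0 < p) _](subrK (\sum_(j < p) x ^+ p.-1)); apply: ndvdD.
  rewrite -sumrB; apply: ndvd_sum => j _.
  have -> : x ^+ p.-1 = x ^+ (p.-1 - j) * x ^+ j.
    by rewrite -exprD subnK // -ltnS prednK ?prime_gt0.
  by rewrite -mulrBr; apply: ndvd_mull; apply: ndvd_exprB.
by rewrite sumr_const card_ord; exists (x ^+ p.-1).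
Qed.

Lemma ndvd_exprpn_lift i x y :
  ndvd p (x - y) -> ndvd (p ^ i.+1) (x ^+ (p ^ i) - y ^+ (p ^ i)).
Proof.
move=> xy; elim: i => [|i IHi]; first by rewrite expn0 expn1 !expr1.
by rewrite (expnSr p i) !exprM; exact: ndvd_exprp_lift.
Qed.

End FrobeniusPower.

Section SeparatingFunctional.
Variable n : nat.

(** Rows are read as polynomials and evaluated at an integer N that is not a root of any nonzero
    difference. The functional serves as a monomial order on a finite support. *)
Lemma separating_functional (s : seq 'rV[int]_n) :
  exists f : {additive 'rV[int]_n -> int}, {in s &, injective f}.
Proof.
pose ds := [seq d <- [seq a - b | a <- s, b <- s] | d != 0].
pose Q := \prod_(d <- ds) rVpoly d.
have Q_neq0 : Q != 0.
  rewrite prodf_seq_neq0; apply/allP => d; rewrite mem_filter => /andP[d0 _] /=.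
  by apply: contraNneq d0 => rd0; rewrite -[d]rVpolyK rd0 raddf0.
have [N rN] : exists N : int, ~~ root Q N.
  apply: contrapT => /forallNP allr.
  suff : (size [seq k%:Z | k <- iota 0 (size Q)] < size Q)%N.
    by rewrite size_map size_iota ltnn.
  apply: max_poly_roots => //; first by apply/allP => k _; apply/negPn/negP/allr.
  by rewrite map_inj_uniq ?iota_uniq // => ? ? [].
exists (horner_eval N \o rVpoly) => a b sa sb /= fab.
apply/eqP; rewrite -subr_eq0; apply: contraNT rN => ab.
rewrite /root horner_prod prodf_seq_eq0; apply/hasP; exists (a - b).
  by rewrite mem_filter ab; apply/allpairsP; exists (a, b).
by rewrite /= raddfB hornerD hornerN subr_eq0; apply/eqP.
Qed.

End SeparatingFunctional.

(** * Laurent polynomials *)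

(* Naming these two operations fixes the choiceType structure that [malg] puts *)
(* on the exponents: it is otherwise inferred in several convertible forms,    *)
(* and comparing them is very slow.                                            *)
Definition lmono n (A : comPzRingType) (u : 'rV[int]_n) (a : A) : laurent n A :=
  << a *g u >>.
Definition lcoef n (A : comPzRingType) (u : 'rV[int]_n) (F : laurent n A) : A :=
  F@_u.

Section Laurent.
Variables (n : nat) (A : comPzRingType).
Implicit Types (F G : laurent n A) (u v w x : 'rV[int]_n) (a b : A).

Fact lmono_is_nmod_morphism u : nmod_morphism (@lmono n A u).
Proof. by split=> [|a b]; [apply: monalgU0|apply: monalgUD]. Qed.
HB.instance Definition _ u := GRing.isNmodMorphism.Build A (laurent n A)
  (@lmono n A u) (lmono_is_nmod_morphism u).

Fact lcoef_is_nmod_morphism u : nmod_morphism (@lcoef n A u).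
Proof. by split=> [|F G]; [apply: mcoeff0|apply: mcoeffD]. Qed.
HB.instance Definition _ u := GRing.isNmodMorphism.Build (laurent n A) A
  (@lcoef n A u) (lcoef_is_nmod_morphism u).

Lemma lmonoD u : {morph @lmono n A u : a b / a + b}.
Proof. exact: raddfD. Qed.

Lemma lcoefD u : {morph @lcoef n A u : F G / F + G}.
Proof. exact: raddfD. Qed.

Lemma lcoef_sum (I : Type) (s : seq I) (P : pred I) (E : I -> laurent n A) u :
  lcoef u (\sum_(i <- s | P i) E i) = \sum_(i <- s | P i) lcoef u (E i).
Proof. exact: raddf_sum. Qed.

Lemma lcoefU u v a : lcoef v (lmono u a) = a *+ (u == v).
Proof. exact: mcoeffU. Qed.

Lemma laurent_msuppE F : F = \sum_(u <- msupp F) lmono u (lcoef u F).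
Proof. exact: laurentE. Qed.

Lemma lcoef_neq0 F u : (lcoef u F != 0) = (u \in msupp F).
Proof. exact: mcoeff_neq0. Qed.

Lemma lmonoM u v a b : lmono u a * lmono v b = lmono (u + v) (a * b).
Proof. exact: laurent_mulUU. Qed.

Lemma laurent1E : 1 = lmono 0 (1 : A) :> laurent n A.
Proof. by []. Qed.

Lemma lmonoX u a k : lmono u a ^+ k = lmono (u *+ k) (a ^+ k).
Proof.
elim: k => [|k IHk]; first by rewrite !expr0 mulr0n.
by rewrite [LHS]exprS IHk lmonoM -exprS -mulrS; reflexivity.
Qed.

Lemma laurent_ind (P : laurent n A -> Prop) :
  (forall u a, P (lmono u a)) -> (forall F G, P F -> P G -> P (F + G)) ->
  forall F, P F.
Proof.
move=> PU PD F; rewrite (laurent_msuppE F); apply: (big_ind P) => //.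
by have := PU 0 0; rewrite raddf0.
Qed.

Lemma lcoefMU F b v x : lcoef x (F * lmono v b) = lcoef (x - v) F * b.
Proof.
elim/laurent_ind: F => [u a|F G IHF IHG]; last first.
  by rewrite mulrDl !lcoefD [RHS]mulrDl; congr (_ + _); [exact: IHF|exact: IHG].
by rewrite lmonoM !lcoefU mulrnAl [u == _]eq_sym subr_eq [x == _]eq_sym.
Qed.

Lemma lcoefM F G x :
  lcoef x (F * G) = \sum_(v <- msupp G) lcoef (x - v) F * lcoef v G.
Proof.
rewrite {1}(laurent_msuppE G) mulr_sumr lcoef_sum.
by apply: eq_bigr => v _; apply: lcoefMU.
Qed.

Lemma ndvd_laurentP q F : ndvd q F <-> forall w, ndvd q (lcoef w F).
Proof.
split=> [[G ->] w|qF]; first by exists (lcoef w G); rewrite raddfMn.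
have /choice[f fP] : forall w, exists a, lcoef w F = a *+ q by exact: qF.
exists (\sum_(w <- msupp F) lmono w (f w)).
rewrite {1}(laurent_msuppE F) -sumrMnl; apply: eq_bigr => w _.
by rewrite fP raddfMn.
Qed.

Lemma lcongP p s F G : lcong p s F G <-> ndvd (p ^ s) (F - G).
Proof.
rewrite ndvd_laurentP; split=> FG w; have [c def_c] := FG w; exists c.
  by rewrite -mulr_natl natrX; exact: def_c.
by rewrite -natrX mulr_natl; exact: def_c.
Qed.

End Laurent.

Local Opaque lmono lcoef laurent_mul laurent_one fgadd fgopp fgzero.

Lemma argmax_seq (T : eqType) (f : T -> int) (s : seq T) : s != [::] ->
  exists2 x, x \in s & forall y, y \in s -> f y <= f x.
Proof.
elim: s => // x s IHs _; have [->|/IHs[y ys ymax]] := eqVneq s [::].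
  by exists x => [|y]; rewrite mem_seq1 // => /eqP->.
have [xy|/ltW yx] := leP (f x) (f y).
  by exists y => [|z]; rewrite inE ?ys ?orbT // => /predU1P[->|/ymax].
exists x => [|z]; first by rewrite mem_head.
by rewrite inE => /predU1P[->|/ymax zy] //; apply: le_trans zy yx.
Qed.

Section LaurentPrime.
Variables (n p : nat) (A : comPzRingType).
Hypothesis A_prime : forall a b : A, ndvd p (a * b) -> ndvd p a \/ ndvd p b.

(** Gauss's lemma: let [u], [v] maximise a separating functional among the exponents whose
    coefficients in [F], [G] are nonzero modulo p. Modulo p, the coefficient of u + v in the product
    is then the single term F_u G_v. *)
Lemma laurent_prime (F G : laurent n A) : ndvd p (F * G) -> ndvd p F \/ ndvd p G.
Proof.
move=> pFG; apply: contrapT => /not_orP[pF pG].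
pose S (H : laurent n A) := [seq w <- msupp H | ~~ `[< ndvd p (lcoef w H) >]].
have memS H w : ~ ndvd p (lcoef w H) -> w \in S H.
  move=> pHw; rewrite mem_filter; apply/andP; split; first exact/asboolPn.
  rewrite -lcoef_neq0; apply/eqP => Hw.
  by apply: pHw; rewrite Hw; apply: ndvd0.
have S_neq0 H : ~ ndvd p H -> S H != [::].
  rewrite ndvd_laurentP => /existsNP[w /memS].
  by apply: contraTneq => ->.
have [f f_inj] := separating_functional (S F ++ S G).
have [u uF umax] := argmax_seq f (S_neq0 F pF).
have [v vG vmax] := argmax_seq f (S_neq0 G pG).
move: (uF) (vG); rewrite !mem_filter => /andP[/asboolPn pu uF'] /andP[/asboolPn pv vG'].
have /ndvd_laurentP/(_ (u + v)) := pFG.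
rewrite lcoefM (big_fsetD1 v) //= addrK => puv.
suff : ndvd p (lcoef u F * lcoef v G) by case/A_prime.
set rest := \sum_(_ <- _) _ in puv; rewrite -[_ * _](addrK rest).
apply: ndvdB => //; rewrite {puv}/rest big_seq; apply: ndvd_sum => w.
rewrite in_fsetD1 => /andP[wv _].
have [pGw|/memS wG] := pselect (ndvd p (lcoef w G)); first exact: ndvd_mull.
have [pFw|/memS wF] := pselect (ndvd p (lcoef (u + v - w) F)); first exact: ndvd_mulr.
case/eqP: wv; apply: f_inj; rewrite ?mem_cat ?wG ?vG ?orbT //.
apply/eqP; rewrite eq_le vmax //=; have := umax _ wF.
by rewrite raddfB raddfD /= lerBlDr lerD2l.
Qed.

End LaurentPrime.

Lemma laurent_mulrn_inj n (A : comPzRingType) q (F : laurent n A) :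
  (forall a : A, a *+ q = 0 -> a = 0) -> F *+ q = 0 -> F = 0.
Proof.
move=> A_inj Fq; rewrite (laurent_msuppE F) big1 // => w _.
by rewrite (A_inj (lcoef w F)) ?raddf0 // -raddfMn Fq raddf0.
Qed.

(** * Frobenius substitutions *)

Section LaurentFrobenius.
Variables (n : nat) (A B : comPzRingType) (phi : {rmorphism A -> B}) (q : nat).
Implicit Types F G : laurent n A.

(** Used at two levels: in z with [phi] the identity it is a power of sigma; in t with [phi] that
    power of sigma it is the substitution (t, z) -> (t^q, z^q). *)
Definition lfrob F : laurent n B := \sum_(w <- msupp F) lmono (w *+ q) (phi (lcoef w F)).

Lemma lfrobEw (d : {fset 'rV[int]_n}) F : (msupp F `<=` d)%fset ->
  lfrob F = \sum_(w <- d) lmono (w *+ q) (phi (lcoef w F)).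
Proof.
move=> Fd; apply: big_fset_incl => // w _; rewrite -lcoef_neq0 negbK => /eqP->.
by rewrite !raddf0.
Qed.

Lemma lfrobU u a : lfrob (lmono u a) = lmono (u *+ q) (phi a).
Proof. by rewrite (lfrobEw msuppU_le) big_seq_fset1 lcoefU eqxx. Qed.

Fact lfrob_is_nmod_morphism : nmod_morphism lfrob.
Proof.
split=> [|F G]; first by rewrite /lfrob msupp0 big_seq_fset0.
rewrite (lfrobEw (msuppD_le F G)) (lfrobEw (fsubsetUl (msupp F) (msupp G))).
rewrite (lfrobEw (fsubsetUr (msupp F) (msupp G))) -big_split /=.
by apply: eq_bigr => w _; rewrite lcoefD rmorphD lmonoD.
Qed.
HB.instance Definition _ := GRing.isNmodMorphism.Build (laurent n A) (laurent n B)
  lfrob lfrob_is_nmod_morphism.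

Lemma lfrobD : {morph lfrob : F G / F + G}.
Proof. exact: raddfD. Qed.

Local Opaque lfrob.

Fact lfrob_is_monoid_morphism : monoid_morphism lfrob.
Proof.
split=> [|F G]; first by rewrite !laurent1E lfrobU rmorph1 mul0rn.
elim/laurent_ind: F => [u a|F F' IHF IHF'].
  elim/laurent_ind: G => [v b|G G' IHG IHG'].
    by rewrite lmonoM !lfrobU lmonoM rmorphM mulrnDl.
  by rewrite mulrDr !lfrobD [RHS]mulrDr; congr (_ + _); [exact: IHG|exact: IHG'].
by rewrite mulrDl !lfrobD [RHS]mulrDl; congr (_ + _); [exact: IHF|exact: IHF'].
Qed.
HB.instance Definition _ := GRing.isMonoidMorphism.Build (laurent n A) (laurent n B)
  lfrob lfrob_is_monoid_morphism.

Lemma lcoef_lfrob_supp F x : lcoef x (lfrob F) != 0 ->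
  exists2 w, x = w *+ q & lcoef w F != 0.
Proof.
move=> Fx; apply: contrapT => noF; case/eqP: Fx.
rewrite lcoef_sum big_seq big1 // => w; rewrite -lcoef_neq0 => Fw.
by rewrite lcoefU; case: eqP => // wx; case: noF; exists w.
Qed.

Lemma lcoefMlfrob (G : laurent n B) F x :
  lcoef x (G * lfrob F) = \sum_(w <- msupp F) lcoef (x - w *+ q) G * phi (lcoef w F).
Proof.
by rewrite mulr_sumr lcoef_sum; apply: eq_bigr => v _; apply: lcoefMU.
Qed.

Hypothesis q_gt0 : (0 < q)%N.

Lemma mulrnI_row : injective (fun w : 'rV[int]_n => w *+ q).
Proof.
move=> u v uv; apply/rowP => i; have /rowP/(_ i) := uv.
by rewrite !mulmxnE => /eqP; rewrite eqr_pMn2r // => /eqP.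
Qed.

Lemma lcoef_lfrob F w : lcoef (w *+ q) (lfrob F) = phi (lcoef w F).
Proof.
elim/laurent_ind: F => [u a|F G IHF IHG]; last first.
  by rewrite lfrobD !lcoefD [RHS]rmorphD; congr (_ + _); [exact: IHF|exact: IHG].
by rewrite lfrobU !lcoefU (inj_eq mulrnI_row) rmorphMn.
Qed.

End LaurentFrobenius.

Local Opaque lfrob.

Lemma iter_lsigma n (A : comPzRingType) p k (F : laurent n A) :
  iter k (lsigma p) F = lfrob idfun (p ^ k) F.
Proof.
elim: k => [|k IHk].
  by rewrite [LHS](laurent_msuppE F); apply: eq_bigr => w _; rewrite expn0 mulr1n.
rewrite iterS {}IHk -[lsigma p _]/(lfrob idfun p _).
elim/laurent_ind: F => [u a|F G IHF IHG]; last first.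
  by rewrite !lfrobD; exact: (f_equal2 _ IHF IHG).
by rewrite !lfrobU expnSr mulrnA.
Qed.

Lemma lfrob_comp n (A : comPzRingType) q q' (F : laurent n A) :
  lfrob idfun q (lfrob idfun q' F) = lfrob idfun (q * q') F.
Proof.
elim/laurent_ind: F => [u a|F G IHF IHG]; last first.
  by rewrite !lfrobD; exact: (f_equal2 _ IHF IHG).
by rewrite !lfrobU mulnC mulrnA.
Qed.

(** Frobenius lifts pass from coefficients to Laurent polynomials: p^k-th powers are additive modulo
    p, and monomials are immediate. *)
Lemma ndvd_lfrob n (A : comPzRingType) (phi : {rmorphism A -> A}) p k
    (F : laurent n A) : prime p ->
  (forall a : A, ndvd p (a ^+ (p ^ k) - phi a)) ->
  ndvd p (F ^+ (p ^ k) - lfrob phi (p ^ k) F).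
Proof.
move=> p_pr phiP; elim/laurent_ind: F => [u a|F G IHF IHG]; last first.
  rewrite lfrobD opprD.
  have := ndvdD (ndvd_exprDpn p_pr k F G) (ndvdD IHF IHG).
  by rewrite [X in _ + X]addrACA [X in ndvd p X -> _]addrA subrK.
by rewrite lmonoX lfrobU -raddfB; apply: ndvd_raddf.
Qed.

Section LaurentDerivation.
Variables (n : nat) (A : comPzRingType) (i : 'I_n).
Implicit Types F G : laurent n A.

Lemma lderivEw (d : {fset 'rV[int]_n}) F : (msupp F `<=` d)%fset ->
  lderiv i F = \sum_(w <- d) lmono (w - delta_mx 0 i) (lcoef w F *~ w 0 i).
Proof.
move=> Fd; apply: big_fset_incl => // w _ /mcoeff_outdom ->.
by rewrite mul0rz monalgU0.
Qed.

Lemma lderivU u (a : A) : lderiv i (lmono u a) = lmono (u - delta_mx 0 i) (a *~ u 0 i).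
Proof. by rewrite (lderivEw msuppU_le) big_seq_fset1 lcoefU eqxx. Qed.

Fact lderiv_is_nmod_morphism : nmod_morphism (@lderiv n A i).
Proof.
split=> [|F G]; first by rewrite /lderiv msupp0 big_seq_fset0.
rewrite (lderivEw (msuppD_le F G)) (lderivEw (fsubsetUl (msupp F) (msupp G))).
rewrite (lderivEw (fsubsetUr (msupp F) (msupp G))) -big_split /=.
by apply: eq_bigr => w _; rewrite lcoefD mulrzDl lmonoD.
Qed.
HB.instance Definition _ := GRing.isNmodMorphism.Build (laurent n A) (laurent n A)
  (@lderiv n A i) lderiv_is_nmod_morphism.

Lemma lderivD : {morph @lderiv n A i : F G / F + G}.
Proof. exact: raddfD. Qed.

Lemma lderivM F G : lderiv i (F * G) = lderiv i F * G + F * lderiv i G.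
Proof.
elim/laurent_ind: F => [u a|F F' IHF IHF']; last first.
  by rewrite mulrDl !lderivD ![in RHS]mulrDl [RHS]addrACA; congr (_ + _);
    [exact: IHF|exact: IHF'].
elim/laurent_ind: G => [v b|G G' IHG IHG']; last first.
  by rewrite mulrDr !lderivD ![in RHS]mulrDr [RHS]addrACA; congr (_ + _);
    [exact: IHG|exact: IHG'].
rewrite lmonoM !lderivU !lmonoM mxE mulrzDr lmonoD mulrzAl mulrzAr.
by rewrite [u - _ + v]addrAC [u + (v - _)]addrA.
Qed.

(** All exponents are multiples of q, and differentiation brings them down as factors; this is the
    source of p^m in the modulus. *)
Lemma lderiv_lfrob_ndvd (phi : {rmorphism A -> A}) q F :
  ndvd q (lderiv i (lfrob phi q F)).
Proof.
elim/laurent_ind: F => [u a|F G IHF IHG]; last by rewrite lfrobD lderivD; apply: ndvdD.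
rewrite lfrobU lderivU mulmxnE; apply: ndvd_raddf.
by exists (phi a *~ u 0 i); rewrite -mulr_natr natz mulrzA pmulrn.
Qed.

End LaurentDerivation.

(** * Newton polytopes *)

Lemma triangular_solution (K : pzRingType) (F : nat -> K) (T : nat -> nat -> K) :
  (forall s, T s s = 1) ->
  exists G : nat -> K, forall s, F s = \sum_(j < s.+1) G j * T j s.
Proof.
(* Each value depends on all earlier ones, so the recursion carries the list of values found so
   far. *)
move=> T1; pose step gs := F (size gs) - \sum_(j < size gs) gs`_j * T j (size gs).
pose fix gs n := if n is n'.+1 then rcons (gs n') (step (gs n')) else [::].
have gs_size n : size (gs n) = n by elim: n => //= n IHn; rewrite size_rcons IHn.
have gs_nth j s : (j < s)%N -> (gs s)`_j = (gs j.+1)`_j.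
  elim: s => // s IHs; rewrite ltnS leq_eqVlt => /predU1P[->//|js] /=.
  by rewrite nth_rcons gs_size js IHs.
exists (fun j => (gs j.+1)`_j) => s; rewrite big_ord_recr /= T1 mulr1.
rewrite nth_rcons gs_size ltnn eqxx /step gs_size addrC.
suff -> : \sum_(j < s) (gs j.+1)`_j * T j s = \sum_(j < s) (gs s)`_j * T j s.
  by rewrite subrK.
by apply: eq_bigr => j _; rewrite [in RHS]gs_nth.
Qed.

Section Support.
Variables (R : realType) (r : nat) (A : comPzRingType).
Implicit Types (S T U : set 'rV[R]_r) (F G : laurent r A).

Definition supported F S := forall v, lcoef v F != 0 -> S (real_pt R v).

Lemma real_ptD v w : real_pt R (v + w) = real_pt R v + real_pt R w :> 'rV[R]_r.
Proof. by rewrite /real_pt map_mxD. Qed.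

Lemma real_ptMn v q : real_pt R (v *+ q) = real_pt R v *+ q :> 'rV[R]_r.
Proof. by rewrite /real_pt raddfMn. Qed.

Lemma real_pt_inj : injective (@real_pt R r).
Proof.
move=> v w /matrixP vw; apply/matrixP => i j; have := vw i j.
by rewrite !mxE => /intr_inj.
Qed.

Lemma supportedM F G S T U : supported F S -> supported G T ->
  (forall x y, S x -> T y -> U (x + y)) -> supported (F * G) U.
Proof.
move=> FS GT SU x FGx; apply: contrapT => Ux; case/eqP: FGx.
rewrite lcoefM big1 // => v _.
have [Gv|Gv] := eqVneq (lcoef v G) 0; first by rewrite Gv mulr0.
have [Fv|Fv] := eqVneq (lcoef (x - v) F) 0; first by rewrite Fv mul0r.
by case: Ux; rewrite -[x](subrK v) real_ptD; apply: SU; [apply: FS|apply: GT].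
Qed.

Lemma supportedB F G S : supported F S -> supported G S -> supported (F - G) S.
Proof.
move=> FS GS v; rewrite raddfB /=; have [Fv|/FS//] := eqVneq (lcoef v F) 0.
by rewrite Fv sub0r oppr_eq0 => /GS.
Qed.

Lemma supported_sum k (E : 'I_k -> laurent r A) S :
  (forall j, supported (E j) S) -> supported (\sum_(j < k) E j) S.
Proof.
move=> ES v Ev; apply: contrapT => Sv; case/eqP: Ev.
rewrite lcoef_sum big1 // => j _; apply/eqP/negPn/negP => /ES.
exact: Sv.
Qed.

Lemma supported1 : supported 1 [set 0].
Proof.
move=> v; rewrite laurent1E lcoefU; case: (0 =P v) => [<- _|]; last by rewrite eqxx.
by rewrite /real_pt map_mx0.
Qed.

Lemma supported_lfrob (B : comPzRingType) (phi : {rmorphism B -> A}) q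
    (F : laurent r B) S :
  (forall v, lcoef v F != 0 -> S (real_pt R v)) ->
  supported (lfrob phi q F) [set x *+ q | x in S].
Proof.
move=> FS v /lcoef_lfrob_supp[w -> /FS Sw].
by exists (real_pt R w) => //; rewrite real_ptMn.
Qed.

Lemma newtonP F : supported F (newton R F).
Proof. by move=> v Fv X [_]; apply; exists v. Qed.

(** Convexity enters here, with z = (q x + y) / (q + 1): sums of q points of N(F) then lie in q
    N(F), which bounds the support of a power. *)
Lemma newton_barycenter F q x y : newton R F x -> newton R F y ->
  exists2 z, newton R F z & x *+ q + y = z *+ q.+1.
Proof.
move=> Fx Fy; exists ((q%:R / q.+1%:R) *: x + (q.+1%:R^-1) *: y); last first.
  rewrite mulrnDl -!scaler_nat !scalerA mulrCA divff ?pnatr_eq0 //.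
  by rewrite mulr1 scale1r.
move=> X XF; have [Xconv _] := XF.
have t0 : 0 <= q%:R / q.+1%:R :> R by rewrite divr_ge0 ?ler0n.
have t1 : q%:R / q.+1%:R <= 1 :> R by rewrite ler_pdivrMr ?ltr0n // mul1r ler_nat.
have := Xconv x y (interval_inference.Itv01 t0 t1) (mem_set (Fx X XF)) (mem_set (Fy X XF)).
move/set_mem; congr (X (_ + _ *: _)); rewrite /= /unstable.onem.
by rewrite -[X in X - _](@divff _ (q.+1%:R : R)) ?pnatr_eq0 // -mulrBl -natrB // subSnn mul1r.
Qed.

Lemma supportedX_newton F q : (0 < q)%N ->
  supported (F ^+ q) [set x *+ q | x in newton R F].
Proof.
case: q => // q _; elim: q => [|q IHq].
  by move=> v Fv; exists (real_pt R v); [apply: newtonP; rewrite expr1 in Fv|].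
rewrite exprSr; apply: supportedM IHq (@newtonP F) _ => _ y [x Fx <-] Fy.
by have [z Fz ->] := newton_barycenter q.+1 Fx Fy; exists z.
Qed.

End Support.

Section WeightedSum.
Variables (R : realType) (r p : nat).
Implicit Types N : nat -> set 'rV[R]_r.

(* N_0 + p N_1 + ... + p^(b-1) N_(b-1) *)
Definition wsum N b : set 'rV[R]_r :=
  [set x | exists2 f : nat -> 'rV[R]_r, forall k, (k < b)%N -> N k (f k) &
           x = \sum_(k < b) f k *+ (p ^ k)].

Lemma wsum_cat N i j x y : wsum N i x -> wsum (fun k => N (i + k)%N) j y ->
  wsum N (i + j) (x + y *+ (p ^ i)).
Proof.
move=> [f fN ->] [g gN ->].
exists (fun k => if (k < i)%N then f k else g (k - i)%N) => [k|].
  have [ki _|ik kij] := ltnP k i; first exact: fN.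
  by rewrite -[in N k](subnKC ik); apply: gN; rewrite ltn_subLR.
rewrite big_split_ord /=; congr (_ + _).
  by apply: eq_bigr => k _; rewrite ltn_ord.
rewrite -sumrMnl; apply: eq_bigr => k _.
by rewrite -mulrnA ltnNge leq_addr /= addKn expnD mulnC.
Qed.

End WeightedSum.

(** * Hasse-Witt matrices *)

Section HasseWitt.
Variables (r p : nat) (A : comPzRingType) (Delta : {fset 'rV[int]_r}).
Implicit Types F G : laurent r A.

Lemma hasse_wittE m F i j :
  hasse_witt p Delta m F i j = lcoef (Delta`_j *+ p ^ m - Delta`_i) F.
Proof. by rewrite mxE. Qed.

Lemma Delta_nth_mem (i : 'I_#|`Delta|) : Delta`_i \in Delta.
Proof. exact: mem_nth. Qed.

Lemma hasse_witt1 : hasse_witt p Delta 0 (1 : laurent r A) = 1%:M.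
Proof.
apply/matrixP=> i j; rewrite hasse_wittE laurent1E lcoefU expn0 mulr1n mxE.
by rewrite eq_sym subr_eq0 (nth_uniq 0) ?fset_uniq // eq_sym mulrb.
Qed.

(** With x = p^m v - w, the term of exponent w in [F] meets the coefficient of [G] at p^j x - u. The
    hypothesis on [G] confines x to [Delta], so the convolution is a matrix product. *)
Lemma hasse_wittM (phi : {rmorphism A -> A}) j m G F : (0 < p)%N ->
  (forall u w, u \in Delta -> lcoef (w *+ p ^ j - u) G != 0 -> w \in Delta) ->
  hasse_witt p Delta (j + m) (G * lfrob phi (p ^ j) F) =
    hasse_witt p Delta j G *m map_mx phi (hasse_witt p Delta m F).
Proof.
move=> p_gt0 GD; apply/matrixP=> a b; rewrite hasse_wittE !mxE lcoefMlfrob.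
set u := Delta`_a; set v := Delta`_b.
pose V := v *+ p ^ m; pose g x := lcoef (x *+ p ^ j - u) G.
pose h w := phi (lcoef w F); pose M := [fset V - w | w in msupp F]%fset.
transitivity (\sum_(x <- M) g x * h (V - x)).
  rewrite big_imfset /=; last by move=> w w' _ _ /addrI/oppr_inj.
  apply: eq_bigr => w _; rewrite /h subKr; congr (lcoef _ G * _).
  by rewrite mulrnBl -mulrnA -expnD addnC addrAC.
(* Both sums equal the one over the union: [g] vanishes off [Delta], and x |-> h (V - x) vanishes
   off [M]. *)
transitivity (\sum_(x <- Delta) g x * h (V - x)).
  rewrite (big_fset_incl _ (fsubsetUl M Delta)) => [|x _ xM].
    rewrite [RHS](big_fset_incl _ (fsubsetUr M Delta)) // => x _ xD.
    rewrite [g x](_ : _ = 0) ?mul0r //; apply/eqP; apply: contraNT xD.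
    exact: GD (Delta_nth_mem a).
  rewrite /h [lcoef _ F](_ : _ = 0) ?rmorph0 ?mulr0 //; apply/eqP.
  apply: contraNT xM; rewrite lcoef_neq0 => Vx.
  by apply/imfsetP; exists (V - x) => //; rewrite subKr.
rewrite (big_nth 0) big_mkord; apply: eq_bigr => k _.
by rewrite !mxE.
Qed.

End HasseWitt.

(** * The Frobenius expansion of window products *)

Section Window.
Variables (r p : nat) (p_pr : prime p) (A : comPzRingType).
Variable sig : nat -> {rmorphism A -> A}.
Hypothesis sigP : forall k (a : A), ndvd p (a ^+ (p ^ k) - sig k a).
Variable L : nat -> laurent r A.
Let p_gt0 : (0 < p)%N := prime_gt0 p_pr.

Definition wprod (L : nat -> laurent r A) b := \prod_(k < b) L k ^+ (p ^ k).

Let T j s := lfrob (sig j.+1) (p ^ j.+1) (wprod (fun k => L (j.+1 + k)%N) (s - j)).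

Let T1 s : T s s = 1.
Proof. by rewrite /T subnn /wprod big_ord0 rmorph1. Qed.

Let TS j s : (j <= s)%N ->
  T j s.+1 = T j s * lfrob (sig j.+1) (p ^ j.+1) (L s.+1) ^+ (p ^ (s - j)).
Proof.
by move=> js; rewrite /T subSn // /wprod big_ord_recr rmorphM rmorphXn /= addSn subnKC.
Qed.

Variable G : nat -> laurent r A.
Hypothesis defG : forall s, wprod L s.+1 = \sum_(j < s.+1) G j * T j s.

Let GE s : G s = wprod L s.+1 - \sum_(j < s) G j * T j s.
Proof. rewrite defG big_ord_recr [X in X - _]addrC. by rewrite addrK T1 mulr1. Qed.

(** Multiplying the expansion at s by L_{s+1}^(p^(s+1)) and subtracting the sum at s + 1 leaves G_j
    T_{j,s} times a difference of p^(s-j)-th powers. Their bases agree modulo p, so that difference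
    gives p^(s-j+1), and [G j] gives p^j. *)
Lemma window_coef_ndvd s : ndvd (p ^ s) (G s).
Proof.
elim/ltn_ind: s => -[|s] IHs; first exact: ndvd1.
rewrite GE {1}/wprod big_ord_recr -/(wprod L s.+1) /= defG mulr_suml -sumrB.
apply: ndvd_sum => j _; have js : (j <= s)%N by rewrite -ltnS.
rewrite -mulrA -mulrBr TS // -mulrBr.
have -> : (p ^ s.+1 = p ^ j * p ^ (s - j).+1)%N by rewrite -expnD addnS subnKC.
apply: ndvd_mul; first exact: IHs.
apply: ndvd_mull; rewrite [in X in _ ^+ X - _]expnS mulnA -expnSr exprM.
by apply: ndvd_exprpn_lift => //; apply: ndvd_lfrob.
Qed.

Section WindowSupport.
Variables (R : realType) (N : nat -> set 'rV[R]_r).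
Hypothesis LN : forall k, N k = newton R (L k).

Lemma supported_wprod i b :
  supported (wprod (fun k => L (i + k)%N) b) (wsum p (fun k => N (i + k)%N) b).
Proof.
elim: b => [|b IHb].
  rewrite /wprod big_ord0 => v /(@supported1 R) -> ; exists (fun => 0) => //.
  by rewrite big_ord0.
rewrite /wprod big_ord_recr /=.
apply: supportedM IHb (supportedX_newton R (F := L (i + b)%N) _) _.
  by rewrite expn_gt0 p_gt0.
move=> x y Nx [z Nz <-]; rewrite -addn1; apply: wsum_cat => //.
exists (fun=> z) => [k|]; first by rewrite ltnS leqn0 => /eqP->; rewrite addn0 LN.
by rewrite big_ord1 expn0 mulr1n.
Qed.

(** The substitution in [T j s] dilates supports by p^(j+1), exactly the weight with which the
    window from j + 1 to s extends the sum bounding [G j]. *)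
Lemma window_coef_supported s : supported (G s) (wsum p N s.+1).
Proof.
elim/ltn_ind: s => s IHs; rewrite GE; apply: supportedB.
  exact: (@supported_wprod 0).
apply: supported_sum => j; apply: supportedM (IHs j _) _ _ => //.
  by apply: supported_lfrob; apply: supported_wprod.
move=> x _ Nx [y Ny <-]; have := wsum_cat Nx Ny.
by rewrite addSn subnKC // ltnW.
Qed.

End WindowSupport.
End Window.

Lemma hasse_witt_window (R : realType) (r p : nat) (A : comPzRingType)
    (sig : nat -> {rmorphism A -> A}) (L : nat -> laurent r A)
    (Delta : {fset 'rV[int]_r}) l :
  prime p -> (forall k (a : A), ndvd p (a ^+ (p ^ k) - sig k a)) ->
  (forall j u w, (j < l)%N -> u \in Delta ->
     wsum p (fun k => newton R (L k)) j.+1 (real_pt R (w *+ p ^ j.+1 - u)) ->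
     w \in Delta) ->
  exists C : nat -> 'M[A]_#|`Delta|,
    [/\ forall j, ndvd (p ^ j) (C j), C 0%N = hasse_witt p Delta 1 (L 0%N) &
     forall s, (s <= l)%N ->
       hasse_witt p Delta s.+1 (wprod p L s.+1) =
       \sum_(j < s.+1) C j *m map_mx (sig j.+1)
         (hasse_witt p Delta (s - j) (wprod p (fun k => L (j.+1 + k)%N) (s - j)))].
Proof.
move=> p_pr sigP adm.
have [|G defG] := triangular_solution (fun s => wprod p L s.+1) (T := fun j s =>
    lfrob (sig j.+1) (p ^ j.+1) (wprod p (fun k => L (j.+1 + k)%N) (s - j))).
  by move=> s; rewrite subnn /wprod big_ord0 rmorph1.
exists (fun j => hasse_witt p Delta j.+1 (G j)); split.
- move=> j; apply/ndvd_mxP => a b; rewrite hasse_wittE; apply: ndvd_raddf.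
  exact: window_coef_ndvd defG j.
- have := defG 0%N; rewrite big_ord1 /= subnn {2}/wprod big_ord0 rmorph1 mulr1 => <-.
  by rewrite /wprod big_ord1 expn0 expr1.
move=> s sl; rewrite defG; apply/matrixP => a b; rewrite hasse_wittE lcoef_sum summxE.
apply: eq_bigr => j _; rewrite -hasse_wittE; congr (fun_of_matrix _ a b).
have [js|sj] := ltnP j s.
  have {1}-> : (s.+1 = j.+1 + (s - j))%N by rewrite addSn subnKC // ltnW.
  rewrite hasse_wittM ?prime_gt0 // => u w Du Gw.
  apply: (adm j u w) => //; first exact: leq_trans js sl.
  exact: (window_coef_supported p_pr defG (R := R) (fun=> erefl)).
(* The term j = s, which may equal l and be out of reach of [adm], has an empty window, whose
   Hasse-Witt matrix at level 0 is the identity. *)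
have {sj} -> : nat_of_ord j = s by apply/eqP; rewrite eqn_leq -ltnS ltn_ord sj.
by rewrite subnn /wprod big_ord0 hasse_witt1 rmorph1 map_mx1 mulmx1 mulr1.
Qed.

Section Admissible.
Variables (R : realType) (r p : nat) (A : comPzRingType) (Delta : {fset 'rV[int]_r}).

Lemma minkowski_sum (I : finType) (P : pred I) (N : I -> set 'rV[R]_r) f :
  (forall i, P i -> N i (f i)) ->
  (\big[@minkowski R r/[set 0]%classic]_(i | P i) N i) (\sum_(i | P i) f i).
Proof.
move=> Nf; apply: (big_rec2 (fun x (S : set 'rV[R]_r) => S x)) => // i x S Pi Sx.
by exists (f i); [exact: Nf|exists x].
Qed.

(** The point p^(j+1) w is the sum of u and a point of the weighted polytope sum, so admissibility
    puts it in p^(j+1) [Delta]. *)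
Lemma admissible_wsum l (Lambda : 'I_l.+1 -> laurent r A) a j u w : (0 < p)%N ->
  admissible p Delta (fun i => newton R (Lambda i)) ->
  (a + j < l)%N -> u \in Delta ->
  wsum p (fun k => newton R (Lambda (inord (a + k)))) j.+1
    (real_pt R (w *+ p ^ j.+1 - u)) ->
  w \in Delta.
Proof.
move=> p_gt0 adm ajl Du [f Nf def_w].
have i_a : (inord a : 'I_l.+1) = a :> nat.
  by rewrite inordK // ltnS (leq_trans _ (ltnW ajl)) ?leq_addr.
have j_aj : (inord (a + j) : 'I_l.+1) = (a + j)%N :> nat by rewrite inordK // ltnW.
have := adm (inord a) (inord (a + j)); rewrite i_a j_aj addKn => /(_ (leq_addr _ _) ajl).
move=> /(_ (real_pt R (w *+ p ^ j.+1)))[|_ [v Dv <-]].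
  split; last by exists (real_pt R w); [exists w|rewrite scaler_nat real_ptMn].
  exists (real_pt R u); first by exists u.
  exists (\sum_(k < l.+1 | (a <= k <= a + j)%N) (p ^ (k - a))%:R *: f (k - a)%N).
    apply: minkowski_sum => k /andP[ak kaj]; exists (f (k - a)%N) => //.
    have := Nf (k - a)%N; rewrite ltnS leq_subLR kaj => /(_ isT).
    by rewrite subnKC // inord_val.
  rewrite -[in RHS](subrK u (w *+ p ^ j.+1)) real_ptD addrC def_w; congr (_ + _).
  pose E k := (p ^ (k - a))%:R *: f (k - a)%N : 'rV[R]_r.
  transitivity (\sum_(a <= k < a + j.+1) E k).
    rewrite (big_nat_widenl _ 0) // (big_nat_widen _ _ l.+1) ?addnS; last by rewrite ltnS ltnW.
    rewrite big_mkord.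
    by apply: eq_bigl => k; rewrite ltnS.
  rewrite -{1}[a]add0n big_addn addKn big_mkord.
  by apply: eq_bigr => k _; rewrite /E addnK scaler_nat.
have q_gt0 : (0 < p ^ j.+1)%N by rewrite expn_gt0 p_gt0.
by rewrite scaler_nat -real_ptMn => /real_pt_inj/(mulrnI_row q_gt0) <-.
Qed.

End Admissible.

(** * The logarithmic derivative *)

Section PadicLaurent.
Variables (n p : nat) (p_pr : prime p).
Implicit Types F : laurent n (padic p).

Lemma padic_laurent_mulp_inj F : F *+ p = 0 -> F = 0.
Proof. by apply: laurent_mulrn_inj => a; apply: padic_mulp_inj. Qed.

Lemma padic_laurent_prime F G : ndvd p (F * G) -> ndvd p F \/ ndvd p G.
Proof. by apply: laurent_prime => a b; apply: padic_prime. Qed.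

Lemma padic_laurent1_ndvd : ~ ndvd p (1 : laurent n (padic p)).
Proof.
move/ndvd_laurentP/(_ 0); rewrite laurent1E lcoefU eqxx mulr1n.
exact: padic1_ndvd.
Qed.

Definition lsig k : {rmorphism laurent n (padic p) -> laurent n (padic p)} :=
  lfrob idfun (p ^ k).

Lemma lsig_comp j k F : lsig j (lsig k F) = lsig (j + k) F.
Proof. by rewrite /lsig /= lfrob_comp expnD. Qed.

Lemma lsig_frobenius k F : ndvd p (F ^+ (p ^ k) - lsig k F).
Proof. by apply: ndvd_lfrob => // a; apply: padic_fermat. Qed.

Lemma lsig_ndvd k F : ndvd p (lsig k F) -> ndvd p F.
Proof.
move=> /ndvd_laurentP pF; apply/ndvd_laurentP => w.
by have := pF (w *+ p ^ k); rewrite /lsig lcoef_lfrob // expn_gt0 prime_gt0.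
Qed.

End PadicLaurent.

Theorem theorem2p8 (R : realType) (p : nat) (p_prime : prime p) (p_odd : odd p)
    (r n l : nat) (Delta : {fset 'rV[int]_r})
    (Lambda : 'I_l.+1 -> laurent r (laurent n (padic p)))
    (Lambda_adm : admissible p Delta (fun i => newton R (Lambda i)))
    (det_nz : forall i, ~ lcong p 1 (\det (hasse_witt p Delta 1 (Lambda i))) 0)
    (v : 'I_n) (s m : nat) (s_ge1 : (1 <= s)%N) (s_lel : (s <= l)%N) :
  let D := map_mx (lderiv v) in
  let sigma_m := iter m (map_mx (lsigma p)) in
  let A1 := hasse_witt p Delta s.+1
    (\prod_(k < l.+1 | (k <= s)%N) Lambda k ^+ (p ^ k)) in
  let A0 := hasse_witt p Delta s
    (\prod_(k < l.+1 | (k < s)%N) Lambda k ^+ (p ^ k)) in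
  lcong_quot p (s + m)
    (D (sigma_m A1)) (sigma_m A1)
    (D (sigma_m A0)) (sigma_m A0).
Proof.
move=> D sigma_m A1 A0; have p_gt0 := prime_gt0 p_prime.
(* Beyond l the value is a default; the windows used below stay within 0, ..., l. *)
pose L k : laurent r (laurent n (padic p)) := Lambda (inord k).
have /choice[C HC] a : exists C : nat -> 'M[laurent n (padic p)]_#|`Delta|,
    (a <= l)%N -> [/\ forall j, ndvd (p ^ j) (C j), C 0%N = hasse_witt p Delta 1 (L a) &
     forall s, (s <= l - a)%N ->
       hasse_witt p Delta s.+1 (wprod p (fun k => L (a + k)%N) s.+1) =
       \sum_(j < s.+1) C j *m map_mx (lsig n p j.+1)
         (hasse_witt p Delta (s - j) (wprod p (fun k => L (a + (j.+1 + k))%N) (s - j)))].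
  have [al|la] := leqP a l; last by exists (fun=> 0).
  have [|C [C1 C2 C3]] := hasse_witt_window (R := R) (L := fun k => L (a + k)%N)
    (Delta := Delta) (l := l - a) p_prime (lsig_frobenius (n := n) p_prime).
    move=> j u w jl; apply: (admissible_wsum (R := R) p_gt0 Lambda_adm).
    by rewrite -ltn_subRL.
  by exists C => _; split=> //; rewrite C2 addn0.
(* The recursion twists the window starting at a by sigma^a; with the twist sigma^m of the theorem
   this makes all coefficients independent of t. *)
pose X a t := map_mx (lsig n p (m + a))
  (hasse_witt p Delta (t - a) (wprod p (fun k => L (a + k)%N) (t - a))).
pose c a j := map_mx (lsig n p (m + a)) (C a (j - a)%N).
have X_nil a : X a a = 1%:M by rewrite /X subnn /wprod big_ord0 hasse_witt1 map_mx1.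
have X_rec a t : (a < t <= l.+1)%N -> X a t = \sum_(a <= j < t) c a j *m X j.+1 t.
  move=> /andP[lt_at tl]; have al : (a <= l)%N by rewrite -ltnS (leq_trans lt_at).
  have [_ _ Hrec] := HC a al.
  have ta : (t - a = (t - a.+1).+1)%N by rewrite -subSn.
  rewrite /X [in LHS]ta Hrec; last by rewrite -(subSS a l); apply: leq_sub2r.
  transitivity (\sum_(j < (t - a.+1).+1) c a (j + a)%N *m X (j + a).+1 t); last first.
    by rewrite -[X in index_iota X t]add0n big_addn ta big_mkord.
  rewrite raddf_sum; apply: eq_bigr => j _.
  rewrite [LHS]map_mxM /c /X addnK -map_mx_comp.
  have -> : (t - (j + a).+1 = t - a.+1 - j)%N by rewrite addnC -addSn subnDA.
  have -> : (fun k => L (a + (j.+1 + k))%N) = (fun k => L ((j + a).+1 + k)%N).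
    by apply/funext => k; rewrite addnA addnS (addnC a).
  congr (_ *m _); apply: eq_map_mx => F.
  have <- : (m + a + j.+1 = m + (j + a).+1)%N by rewrite !addnS -addnA (addnC a).
  exact: lsig_comp.
have c_small a j : (a <= j <= l)%N -> ndvd (p ^ (j - a)) (c a j).
  move=> /andP[aj jl]; have [Cj _ _] := HC a (leq_trans aj jl).
  by apply: ndvd_raddf; apply: Cj.
have Dc_small a j : (a <= j <= l)%N -> ndvd (p ^ (m + j)) (map_mx (lderiv v) (c a j)).
  move=> /andP[aj jl]; have [Cj _ _] := HC a (leq_trans aj jl).
  have [Y CY] := Cj (j - a)%N.
  (* The exponent m + j splits as (m + a) + (j - a): the first part comes from differentiating an
     image of sigma^(m+a), the second from [C]. *)
  rewrite /c CY !raddfMn -(subnKC aj) addnA expnD addKn; apply: ndvdMn.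
  by apply/ndvd_mxP => i k; rewrite !mxE; apply: lderiv_lfrob_ndvd.
have det_c a : (a <= l)%N -> ~ ndvd p (\det (c a a)).
  move=> al; have [_ C0 _] := HC a al.
  rewrite /c subnn C0 det_map_mx => /lsig_ndvd pdet; apply: (det_nz (inord a)).
  by apply/lcongP; rewrite subr0 expn1; exact: pdet.
have sigE t : sigma_m (hasse_witt p Delta t (wprod p L t)) = X 0%N t.
  rewrite /X subn0 addn0 /sigma_m; apply/matrixP => i j.
  rewrite [RHS]mxE; set H := hasse_witt _ _ _ _.
  transitivity (iter m (lsigma p) (H i j)); last exact: iter_lsigma.
  by elim: (m) => [|k IHk] //=; rewrite mxE; congr (lsigma p _).
have wprodE t : (t <= l.+1)%N ->
    \prod_(k < l.+1 | (k < t)%N) Lambda k ^+ (p ^ k) = wprod p L t.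
  move=> tl; rewrite /wprod -(big_mkord xpredT (fun k => L k ^+ (p ^ k))).
  rewrite (big_nat_widen _ _ l.+1) // big_mkord /=; apply: eq_bigr => k _.
  by rewrite /L inord_val.
have E1 : sigma_m A1 = X 0%N s.+1 by rewrite -sigE -wprodE.
have E0 : sigma_m A0 = X 0%N s by rewrite -sigE -wprodE // leqW.
have prK := @padic_laurent_prime n p p_prime.
have detX t : (t <= l.+1)%N -> ~ lcong p 1 (\det (X 0%N t)) 0.
  move=> tl; rewrite lcongP subr0 expn1.
  by apply: (det_window prK (@padic_laurent1_ndvd n p p_prime) X_nil X_rec c_small det_c).
rewrite E1 E0; split; [exact: detX|by apply: detX; apply: leqW|move=> i j].
apply/lcongP; rewrite addnC.
exact: (window_derive_quot (@padic_laurent_mulp_inj n p p_prime) prK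
  (@padic_laurent1_ndvd n p p_prime) (@lderivM n (padic p) v) X_nil X_rec c_small
  Dc_small det_c s_lel).
Qed.
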